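(* Consider straight line regression, $p=2$ and $\mathbf{f}(x)=(1,x)^\top$, with diagonal $\mathbf{D}=\mathrm{diag}(d_1,d_2)$, $d_1,d_2>0$, on the experimental region $\mathcal{X}=[0,a]$ with $a>0$ or $\mathcal{X}=[-b,b]$ with $b>0$. Then, for each of these regions, the D- and G-criteria for the prediction of individual parameters are equivalent: an approximate design on $\mathcal{X}$ with non-singular information matrix is D-optimal if and only if it is G-optimal.
   Context: Random coefficients regression model: $Y_{ij}=\mathbf{f}(x_j)^\top\boldsymbol{\beta}_i+\varepsilon_{ij}$, $j=1,\dots,m$, $i=1,\dots,n$, with $m,n\ge 1$, uncorrelated zero-mean errors of variance $\sigma^2>0$, and individual parameters $\boldsymbol{\beta}_i$ with unknown mean and $\mathrm{Cov}(\boldsymbol{\beta}_i)=\sigma^2\mathbf{D}$. Put $\mathbf{\Delta}=m\,\mathbf{D}$. An approximate design $\xi$ on $\mathcal{X}$ consists of finitely many distinct points $x_1,\dots,x_k\in\mathcal{X}$ with weights $w_j\ge 0$, $\sum_{j=1}^k w_j=1$; its information matrix is $\mathbf{M}(\xi)=\sum_{j=1}^k w_j\,\mathbf{f}(x_j)\mathbf{f}(x_j)^\top$. Only designs with non-singular $\mathbf{M}(\xi)$ are considered. The (standardized) mean squared error matrix for the best linear unbiased prediction of $(\boldsymbol{\beta}_1^\top,\dots,\boldsymbol{\beta}_n^\top)^\top$ is $$\mathrm{MSE}(\xi)=\tfrac1n\left(\mathbf{1}_n\mathbf{1}_n^\top\right)\otimes\mathbf{M}(\xi)^{-1}+\left(\mathbf{I}_n-\tfrac1n\mathbf{1}_n\mathbf{1}_n^\top\right)\otimes\left(\mathbf{M}(\xi)+\mathbf{\Delta}^{-1}\right)^{-1},$$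 where $\mathbf{1}_n$ is the all-ones vector of length $n$, $\mathbf{I}_n$ the identity matrix, and $\otimes$ the Kronecker product. A design is D-optimal (for the prediction) if it minimizes $\det\mathrm{MSE}(\xi)$, equivalently $-\log\det\mathbf{M}(\xi)-(n-1)\log\det\left(\mathbf{M}(\xi)+\mathbf{\Delta}^{-1}\right)$, over all approximate designs on $\mathcal{X}$ with non-singular information matrix. A design is G-optimal (for the prediction) if it minimizes $$\Phi_G(\xi)=\max_{x\in\mathcal{X}}\left(\mathbf{f}(x)^\top\left(\mathbf{M}(\xi)^{-1}+(n-1)\left(\mathbf{M}(\xi)+\mathbf{\Delta}^{-1}\right)^{-1}\right)\mathbf{f}(x)\right)$$ over the same class of designs. *)

(* Defs.v *)
From HB Require Import structures.
From mathcomp Require Import all_boot all_order all_algebra.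
From mathcomp Require Import all_classical all_reals all_analysis.
From mathcomp Require Import mxtens.
Set Implicit Arguments.
Unset Strict Implicit.
Unset Printing Implicit Defensive.
Import Order.TTheory GRing.Theory Num.Theory.
Import numFieldNormedType.Exports.
Local Open Scope classical_set_scope.
Local Open Scope ring_scope.

Record design (R : realType) (X : set R) := Design {
  design_size : nat ;
  design_pt : 'I_design_size -> R ;
  design_wt : 'I_design_size -> R ;
  design_pt_inj : injective design_pt ;
  design_pt_in : forall j, X (design_pt j) ;
  design_wt_ge0 : forall j, 0 <= design_wt j ;
  design_wt_sum : \sum_j design_wt j = 1 }.
Arguments design_pt {R X} d _.
Arguments design_wt {R X} d _.
Arguments design_pt_inj {R X} d.
Arguments design_pt_in {R X} d j.
Arguments design_wt_ge0 {R X} d j.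

Definition information (R : realType) (X : set R) (p : nat)
    (f : R -> 'cV[R]_p) (xi : design X) : 'M[R]_p :=
  \sum_(j < design_size xi) design_wt xi j *:
    (f (design_pt xi j) *m (f (design_pt xi j))^T).

Definition nonsingular (R : realType) (X : set R) (p : nat)
    (f : R -> 'cV[R]_p) (xi : design X) : bool :=
  information f xi \in unitmx.

Definition ones (R : realType) (n : nat) : 'cV[R]_n := const_mx 1.

(* Here [Delta] is m D, with m the number of observations per individual and
   D the covariance matrix of the individual parameters in units of the error
   variance.  [*t] is the Kronecker product. *)
Definition MSE (R : realType) (X : set R) (p : nat) (f : R -> 'cV[R]_p)
    (n : nat) (Delta : 'M[R]_p) (xi : design X) : 'M[R]_(n * p) :=
  (n%:R^-1 *: (ones R n *m (ones R n)^T)) *t invmx (information f xi) +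
  (1%:M - n%:R^-1 *: (ones R n *m (ones R n)^T)) *t
    invmx (information f xi + invmx Delta).

Definition sensitivity (R : realType) (X : set R) (p : nat)
    (f : R -> 'cV[R]_p) (n : nat) (Delta : 'M[R]_p) (xi : design X)
    (x : R) : R :=
  ((f x)^T *m (invmx (information f xi) +
      n.-1%:R *: invmx (information f xi + invmx Delta)) *m f x) 0 0.

(* The supremum is a maximum when X is compact and nonempty and f is
   continuous: see [PhiG_max] below. *)
Definition PhiG (R : realType) (X : set R) (p : nat) (f : R -> 'cV[R]_p)
    (n : nat) (Delta : 'M[R]_p) (xi : design X) : R :=
  sup [set sensitivity f n Delta xi x | x in X].

Definition D_optimal (R : realType) (X : set R) (p : nat)
    (f : R -> 'cV[R]_p) (n : nat) (Delta : 'M[R]_p) (xi : design X) : Prop :=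
  nonsingular f xi /\
  forall eta : design X, nonsingular f eta ->
    \det (MSE f n Delta xi) <= \det (MSE f n Delta eta).

Definition G_optimal (R : realType) (X : set R) (p : nat)
    (f : R -> 'cV[R]_p) (n : nat) (Delta : 'M[R]_p) (xi : design X) : Prop :=
  nonsingular f xi /\
  forall eta : design X, nonsingular f eta ->
    PhiG f n Delta xi <= PhiG f n Delta eta.

Definition straight_line (R : realType) (x : R) : 'cV[R]_2 :=
  \col_(i < 2) [:: 1; x]`_i.

Definition diag2 (R : realType) (d1 d2 : R) : 'M[R]_2 :=
  diag_mx (\row_(i < 2) [:: d1; d2]`_i).

Lemma continuous_sensitivity (R : realType) (X : set R) (p : nat)
    (f : R -> 'cV[R]_p) (n : nat) (Delta : 'M[R]_p) (xi : design X) :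
  (forall i, continuous (fun x => f x i 0)) ->
  continuous (sensitivity f n Delta xi).
Proof.
move=> cf; rewrite /sensitivity; set A := _ + _.
have -> : (fun x => ((f x)^T *m A *m f x) 0 0) =
    (fun x => \sum_i (\sum_j f x j 0 * A j i) * f x i 0).
  apply/funext => x; rewrite mxE; apply: eq_bigr => i _; rewrite mxE.
  by congr (_ * _); apply: eq_bigr => j _; rewrite mxE.
apply: continuous_big; first exact: add_continuous.
move=> i _ x; apply: cvgM; last exact: cf.
apply: (@continuous_big _ _ _ _ _ _ _ _ (fun j y => f y j 0 * A j i)).
  exact: add_continuous.
by move=> j _ y; apply: cvgM; [exact: cf | exact: cvg_cst].
Qed.

Lemma PhiG_max (R : realType) (X : set R) (p : nat) (f : R -> 'cV[R]_p)
    (n : nat) (Delta : 'M[R]_p) (xi : design X) :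
  compact X -> X !=set0 -> (forall i, continuous (fun x => f x i 0)) ->
  exists2 x, X x & PhiG f n Delta xi = sensitivity f n Delta xi x /\
    forall y, X y -> sensitivity f n Delta xi y <= PhiG f n Delta xi.
Proof.
move=> cX X0 cf.
have cs : {within X, continuous (sensitivity f n Delta xi)}.
  exact/continuous_subspaceT/continuous_sensitivity.
have [c Xc cmax] := compact_EVT_max X0 cX cs.
have {}Xc : X c by rewrite -in_setE.
have {}cmax y : X y -> sensitivity f n Delta xi y <= sensitivity f n Delta xi c.
  by move=> Xy; apply: cmax; rewrite in_setE.
have e : PhiG f n Delta xi = sensitivity f n Delta xi c.
  apply/eqP; rewrite eq_le; apply/andP; split.
    by apply: ge_sup; [exists (sensitivity f n Delta xi c), c|move=> _ [y Xy <-]; exact: cmax].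
  apply: ub_le_sup; last by exists c.
  by exists (sensitivity f n Delta xi c) => _ [y Xy <-]; exact: cmax.
by exists c => //; split => // y Xy; rewrite e; exact: cmax.
Qed.

Lemma continuous_straight_line (R : realType) (i : 'I_2) :
  continuous (fun x : R => straight_line x i 0).
Proof.
case: i => [[|[|//]]] i x.
- have -> : (fun x : R => straight_line x (Ordinal i) 0) = cst 1.
    by apply/funext => y; rewrite mxE.
  exact: cvg_cst.
- have -> : (fun x : R => straight_line x (Ordinal i) 0) = id.
    by apply/funext => y; rewrite mxE.
  exact: cvg_id.
Qed.

(* Main.v *)
(** With q and r the first two moments of a design, c = 1 + 1/(m d1) and
    e = 1/(m d2), both criteria depend on (q, r) only: the D-criterion is
    1 / ((r - q^2) (c (r + e) - q^2)^(n-1)), by Sylvester's determinant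
    identity, and the sensitivity is a convex quadratic function of x. For each
    region a single pair (q0, r0) strictly beats every other one for both
    criteria. On [0, a] one has r <= a q and r0 = a q0, where q0 is the critical
    point of the D-criterion along the edge r = a q. Up to a nonzero factor the
    derivative of the D-criterion along the edge is the difference of the
    sensitivities at a and at 0, so these agree at q0. Along the edge the
    sensitivity increases with q at 0 and decreases with q at a, and it decreases
    with r everywhere, so away from (q0, r0) one endpoint is worse. On [-b, b]
    the optimal pair is (0, b^2). *)
Require Import Defs.
From mathcomp Require Import all_boot all_order all_algebra.
From mathcomp Require Import all_classical all_reals all_analysis.
From mathcomp Require Import mxtens ring lra.
Import Order.TTheory GRing.Theory Num.Theory.
Import numFieldNormedType.Exports.
Local Open Scope classical_set_scope.
Local Open Scope ring_scope.

(** * The determinant of the mean squared error matrix *)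

Lemma det_castmx (K : comPzRingType) (m n : nat) (e1 e2 : m = n) (A : 'M[K]_m) :
  \det (castmx (e1, e2) A) = \det A.
Proof. by case: _ / e1 in e2 *; rewrite castmx_id. Qed.

(** Sylvester's identity: multiplying the block matrix with rows [1, - A] and [B, 1] by the
    unipotent one with rows [1, 0] and [- B, 1], on the left or on the right, gives a block
    triangular matrix whose determinant is one side or the other. *)
Lemma det_1D_mulmxC (K : comPzRingType) (m n : nat) (A : 'M[K]_(m, n))
    (B : 'M[K]_(n, m)) :
  \det (1%:M + A *m B) = \det (1%:M + B *m A).
Proof.
have e : block_mx 1%:M 0 (- B) 1%:M *m block_mx 1%:M (- A) B 1%:M =
    block_mx 1%:M (- A) 0 (1%:M + B *m A).
  rewrite mulmx_block !mul1mx !mul0mx !addr0 mulmx1 mulNmx mulmxN opprK addNr.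
  by rewrite addrC.
have e' : block_mx 1%:M (- A) B 1%:M *m block_mx 1%:M 0 (- B) 1%:M =
    block_mx (1%:M + A *m B) (- A) 0 1%:M.
  by rewrite mulmx_block !mul1mx !mulmx0 !mulmx1 !add0r mulNmx mulmxN opprK subrr.
have := congr1 determinant e; have := congr1 determinant e'.
by rewrite !det_mulmx !det_ublock !det_lblock !det1 !mul1r !mulr1 => -> ->.
Qed.

Lemma tensmxDr (K : pzRingType) (m n p q : nat) (A : 'M[K]_(m, n))
    (B C : 'M[K]_(p, q)) : A *t (B + C) = A *t B + A *t C.
Proof. by apply/matrixP => i j; rewrite !mxE mulrDr. Qed.

Lemma tensmxBl (K : pzRingType) (m n p q : nat) (A B : 'M[K]_(m, n))
    (C : 'M[K]_(p, q)) : (A - B) *t C = A *t C - B *t C.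
Proof. by apply/matrixP => i j; rewrite !mxE mulrBl. Qed.

Lemma tensmx11 (K : comPzRingType) (m n : nat) :
  1%:M *t 1%:M = 1%:M :> 'M[K]_(m * n).
Proof.
apply/matrixP => i j; case: (mxtens_indexP i) => i0 i1.
case: (mxtens_indexP j) => j0 j1; rewrite tensmxE !mxE.
by rewrite (can_eq (@mxtens_indexK _ _)) xpair_eqE -natrM mulnb.
Qed.

Lemma det_tens1mx (K : comPzRingType) (n p : nat) (B : 'M[K]_p) :
  \det ((1%:M : 'M[K]_n) *t B) = \det B ^+ n.
Proof.
elim: n => [|n IH]; first by rewrite det_mx00 expr0.
rewrite -[n.+1]/(1 + n)%N (scalar_mx_block 1 n) tens_block_mx det_castmx.
rewrite !tens0mx det_ublock IH exprS; congr (_ * _).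
by rewrite tens_scalar_mx det_castmx scale1r.
Qed.

(** With [P] the projection onto the all-ones vector, the matrix factors as I ⊗ B times I + P ⊗ C,
    where 1 + C = B^-1 A. Since [P] has rank one, Sylvester's identity reduces the second
    determinant to that of 1 + C. *)
Lemma det_MSE (R : realType) (X : set R) (p : nat) (f : R -> 'cV[R]_p)
    (N : nat) (Delta : 'M[R]_p) (xi : design X) :
  information f xi + invmx Delta \in unitmx ->
  \det (MSE f N.+1 Delta xi) =
    (\det (information f xi) * \det (information f xi + invmx Delta) ^+ N)^-1.
Proof.
move=> uB; rewrite /MSE; set A := invmx _; set B := invmx (_ + _).
have uB' : B \in unitmx by rewrite unitmx_inv.
set n := N.+1; set P := _ *: _; set C := invmx B *m (A - B).
have -> : P *t A + (1%:M - P) *t B =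
    ((1%:M : 'M[R]_n) *t B) *m (1%:M + P *t C).
  rewrite mulmxDr mulmx1 tensmx_mul mul1mx mulKVmx // tensmxBl.
  by rewrite -[in LHS](subrK B A) tensmxDr addrC [_ + P *t B]addrC addrA subrK.
rewrite det_mulmx det_tens1mx.
have -> : P *t C = (ones R n *t 1%:M) *m ((n%:R^-1 *: (ones R n)^T) *t C).
  by rewrite tensmx_mul mul1mx -scalemxAr.
rewrite det_1D_mulmxC tensmx_mul mulmx1.
have -> : (n%:R^-1 *: (ones R n)^T) *m ones R n = 1%:M.
  apply/matrixP => i j; rewrite !mxE !ord1 eqxx.
  under eq_bigr do rewrite !mxE mulr1.
  by rewrite sumr_const card_ord -[LHS]mulr_natl mulr1 mulfV ?pnatr_eq0.
rewrite -tensmx11 -tensmxDr det_tens1mx expr1.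
have -> : 1%:M + C = invmx B *m A by rewrite /C mulmxBr mulVmx // addrC subrK.
rewrite det_mulmx !det_inv invrK invfM -exprVn /n exprS.
set b := \det (_ + _); have b0 : b != 0 by rewrite -unitfE -unitmxE.
by rewrite mulrACA mulVf // mul1r mulrC.
Qed.

(** * Quadratic forms of inverse matrices of order two *)

(* f(x)^T M^-1 f(x) for f(x) = (1, x)^T and M = [[p, q], [q, r]]. *)
Definition quad {K : fieldType} (p q r x : K) : K :=
  (r - 2 * q * x + p * x ^+ 2) / (p * r - q ^+ 2).

(** Completing the square leaves only the determinant and the distance from [q] to [p * x] to be
    compared. *)
Lemma quadE (K : fieldType) (p q r x : K) : p != 0 -> p * r - q ^+ 2 != 0 ->
  quad p q r x = p^-1 + (q - p * x) ^+ 2 / (p * (p * r - q ^+ 2)).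
Proof. by move=> p0 D0; rewrite /quad; field; apply/andP. Qed.

Lemma le_quad (K : realFieldType) (p q r q' r' x : K) : 0 < p ->
  0 < p * r - q ^+ 2 -> p * r - q ^+ 2 <= p * r' - q' ^+ 2 ->
  (q' - p * x) ^+ 2 <= (q - p * x) ^+ 2 ->
  quad p q' r' x <= quad p q r x.
Proof.
move=> p0 D0 DD' qq'; have D'0 := lt_le_trans D0 DD'.
rewrite !quadE ?gt_eqF// lerD2l; apply: ler_pM => //; first exact: sqr_ge0.
  by rewrite invr_ge0 ltW ?mulr_gt0.
by rewrite lef_pV2 ?posrE ?mulr_gt0 // ler_pM2l.
Qed.

(** Strictness comes from the determinants, so the numerator must not vanish; [q' != p * x] ensures
    this. *)
Lemma lt_quad (K : realFieldType) (p q r q' r' x : K) : 0 < p ->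
  0 < p * r - q ^+ 2 -> p * r - q ^+ 2 < p * r' - q' ^+ 2 ->
  (q' - p * x) ^+ 2 <= (q - p * x) ^+ 2 -> q' != p * x ->
  quad p q' r' x < quad p q r x.
Proof.
move=> p0 D0 DD' qq' q'0; have D'0 := lt_trans D0 DD'.
have q'x : 0 < (q' - p * x) ^+ 2 by rewrite exprn_even_gt0 // subr_eq0.
rewrite !quadE ?gt_eqF// ltrD2l.
apply: (@lt_le_trans _ _ ((q' - p * x) ^+ 2 / (p * (p * r - q ^+ 2)))).
  by rewrite ltr_pM2l // ltf_pV2 ?posrE ?mulr_gt0 // ltr_pM2l.
by apply: ler_wpM2r => //; rewrite invr_ge0 ltW ?mulr_gt0.
Qed.

(** From q^2 < a q <= c (a q + e). The values c = 1 and e = 0 are allowed so that this and the next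
    two lemmas apply to M as well as to M + Delta^-1. *)
Lemma edge_det_gt0 (K : realFieldType) (a c e q : K) :
  1 <= c -> 0 <= e -> 0 < q -> q < a -> 0 < c * (a * q + e) - q ^+ 2.
Proof.
move=> c1 e0 q0 qa; have aq : q * q < a * q by rewrite ltr_pM2r.
have : a * q + e <= c * (a * q + e) by rewrite ler_peMl //; nra.
by rewrite expr2; lra.
Qed.

(** After clearing denominators the difference is [q' - q] times a positive cofactor. *)
Lemma quad0_edge_lt (K : realFieldType) (a c e q q' : K) :
  1 <= c -> 0 <= e -> 0 < q -> q < q' -> q' < a ->
  quad c q (a * q + e) 0 < quad c q' (a * q' + e) 0.
Proof.
move=> c1 e0 q0 qq' q'a.
have D0 : 0 < c * (a * q + e) - q ^+ 2 by apply: edge_det_gt0 => //; lra.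
have D'0 : 0 < c * (a * q' + e) - q' ^+ 2 by apply: edge_det_gt0 => //; lra.
rewrite /quad !mulr0 expr0n /= !mulr0 !subr0 !addr0.
rewrite ltr_pdivrMr // mulrAC ltr_pdivlMr //.
rewrite -subr_gt0.
have -> : (a * q' + e) * (c * (a * q + e) - q ^+ 2) -
    (a * q + e) * (c * (a * q' + e) - q' ^+ 2) =
    (q' - q) * (a * (q * q') + e * (q + q')) by ring.
apply: mulr_gt0; first lra.
apply: ltr_wpDr; first by apply: mulr_ge0; lra.
by do 2?[apply: mulr_gt0]; lra.
Qed.

(** A similar factorisation; the cofactor is positive because c a exceeds both q and q'. *)
Lemma quad_edge_lt (K : realFieldType) (a c e q q' : K) :
  1 <= c -> 0 <= e -> 0 < q -> q < q' -> q' < a ->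
  quad c q' (a * q' + e) a < quad c q (a * q + e) a.
Proof.
move=> c1 e0 q0 qq' q'a.
have D0 : 0 < c * (a * q + e) - q ^+ 2 by apply: edge_det_gt0 => //; lra.
have D'0 : 0 < c * (a * q' + e) - q' ^+ 2 by apply: edge_det_gt0 => //; lra.
rewrite /quad ltr_pdivrMr // [ltRHS]mulrAC ltr_pdivlMr // -subr_gt0.
set L := (X in 0 < X).
have -> : L =
    (q' - q) * (a * ((c * a - q) * (c * a - q')) +
      e * ((c * a - q) + (c * a - q'))) by rewrite /L; ring.
have qa : 0 < c * a - q by nra.
have q'a' : 0 < c * a - q' by nra.
apply: mulr_gt0; first lra.
apply: ltr_wpDr; first by apply: mulr_ge0; lra.
by do 2?[apply: mulr_gt0]; lra.
Qed.

(** A convex parabola lies below its chord; over the common denominator this is p x^2 <= p x a. *)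
Lemma quad_chord (K : realFieldType) (a p q r x : K) :
  0 < p -> 0 < p * r - q ^+ 2 -> 0 < a -> 0 <= x -> x <= a ->
  quad p q r x <= quad p q r 0 + x / a * (quad p q r a - quad p q r 0).
Proof.
move=> p0 D0 a0 x0 xa; rewrite /quad; set D := p * r - q ^+ 2.
rewrite [leRHS](_ : _ = (r + x * (p * a - 2 * q)) / D); last first.
  by field; rewrite !gt_eqF.
rewrite ler_pM2r ?invr_gt0 //.
have : p * (x * x) <= p * (x * a) by rewrite ler_pM2l // ler_wpM2l.
by rewrite expr2; lra.
Qed.

(** * First-order conditions for the D-criterion *)

(* 1 + t <= exp t turns the first-order bound into a bound on the product. *)
Lemma mul_exprn_lt (R : realType) (N : nat) (x y x0 y0 : R) :
  0 < x -> 0 < y -> 0 < x0 -> 0 < y0 ->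
  (x - x0) / x0 + N%:R * ((y - y0) / y0) < 0 ->
  x * y ^+ N < x0 * y0 ^+ N.
Proof.
move=> hx hy hx0 hy0 h.
have E z z0 : 0 < z0 -> z / z0 <= expR ((z - z0) / z0).
  by move=> z00; rewrite (le_trans _ (expR_ge1Dx _)) // mulrBl divff ?gt_eqF//; lra.
have : x / x0 * (y / y0) ^+ N < 1.
  apply: le_lt_trans (_ : expR ((x - x0) / x0) * expR ((y - y0) / y0) ^+ N < 1).
    apply: ler_pM; [by rewrite divr_ge0 ?ltW| |exact: E|].
      by rewrite exprn_ge0 // divr_ge0 ?ltW.
    by apply: lerXn2r; rewrite ?nnegrE ?expR_ge0 ?divr_ge0 ?E ?ltW.
  by rewrite -expRM_natl -expRD expR_lt1.
by rewrite expr_div_n mulrACA -invfM ltr_pdivrMr ?mul1r // mulr_gt0 ?exprn_gt0.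
Qed.

(* The sum is the derivative, along the edge r = a q, of the logarithm of
   (r - q^2) (c (r + e) - q^2)^N. *)
Lemma edge_balance (R : realType) (N : nat) (a c e : R) :
  0 < a -> 1 < c -> 0 < e ->
  exists2 q, 0 < q < a &
    (a - 2 * q) / (a * q - q ^+ 2) +
      N%:R * ((c * a - 2 * q) / (c * (a * q + e) - q ^+ 2)) = 0.
Proof.
move=> a0 c1 e0.
(* [P] is the sum with its denominators cleared; it is positive at 0 and negative at [a]. *)
pose P : {poly R} := (a%:P - 2 *: 'X) * (c *: (a *: 'X + e%:P) - 'X^2) +
  N%:R *: (((c * a)%:P - 2 *: 'X) * (a *: 'X - 'X^2)).
have PE q : P.[q] = (a - 2 * q) * (c * (a * q + e) - q ^+ 2) +
    N%:R * ((c * a - 2 * q) * (a * q - q ^+ 2)).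
  by rewrite /P !hornerE /= ?expr2.
have P0 : 0 < P.[0].
  rewrite PE expr0n /= !(mulr0, subr0, addr0, add0r).
  by rewrite !mulr_gt0 //; lra.
have Pa : P.[a] < 0.
  rewrite PE -expr2 subrr !mulr0 addr0.
  have -> : (a - 2 * a) * (c * (a ^+ 2 + e) - a ^+ 2) =
    - (a * ((c - 1) * a ^+ 2 + c * e)) by ring.
  by rewrite oppr_lt0 mulr_gt0 // addr_gt0 // mulr_gt0 ?exprn_gt0 //; lra.
have [|q /andP[q0 qa] /rootP Pq] := @poly_ivt _ (- P) 0 a (ltW a0).
  by rewrite !hornerN oppr_le0 oppr_ge0 !ltW.
have {}Pq : P.[q] = 0 by apply/eqP; rewrite -oppr_eq0 -hornerN Pq.
have {}q0 : 0 < q.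
  rewrite lt_neqAle q0 andbT; apply: contraTneq P0 => eq0.
  by move: Pq; rewrite -eq0 => ->; rewrite ltxx.
have {}qa : q < a.
  rewrite lt_neqAle qa andbT; apply: contraTneq Pa => eqa.
  by move: Pq; rewrite eqa => ->; rewrite ltxx.
exists q; first by rewrite q0.
have D : 0 < c * (a * q + e) - q ^+ 2 by apply: edge_det_gt0 => //; lra.
have D1 : 0 < a * q - q ^+ 2 by nra.
have -> : (a - 2 * q) / (a * q - q ^+ 2) +
  N%:R * ((c * a - 2 * q) / (c * (a * q + e) - q ^+ 2)) =
  P.[q] / ((a * q - q ^+ 2) * (c * (a * q + e) - q ^+ 2)).
  by rewrite PE; field; rewrite !gt_eqF.
by rewrite Pq mul0r.
Qed.

(** * Comparison of moments on [0, a] *)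

(** The determinant of M + Delta^-1 is the sum of (c - 1) (r + e), r - q^2 and e. *)
Lemma pencil_det_gt0 (K : realFieldType) (c e q r : K) :
  1 < c -> 0 < e -> q ^+ 2 < r -> 0 < c * (r + e) - q ^+ 2.
Proof.
move=> c1 e0 qr; have q2 := sqr_ge0 q.
have : 0 < (c - 1) * (r + e) by apply: mulr_gt0; lra.
by lra.
Qed.

(** The sensitivity in terms of moments, with N = n - 1; c, q and r + e are the entries of M +
    Delta^-1. *)
Definition sens {K : fieldType} (N : nat) (c e q r x : K) : K :=
  quad 1 q r x + N%:R * quad c q (r + e) x.

(** This is the first-order hypothesis of [mul_exprn_lt]. The balance equation removes the term
    linear in q - q0; what remains is minus a positive combination of the slack a q - r and of (q -
    q0)^2, which vanish together only at the optimum. *)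
Lemma edge_D_lt (K : realFieldType) (N : nat) (a c e q r q0 : K) :
  1 < c -> 0 < a * q0 - q0 ^+ 2 -> 0 < c * (a * q0 + e) - q0 ^+ 2 ->
  (a - 2 * q0) / (a * q0 - q0 ^+ 2) +
    N%:R * ((c * a - 2 * q0) / (c * (a * q0 + e) - q0 ^+ 2)) = 0 ->
  r <= a * q -> (q, r) != (q0, a * q0) ->
  (r - q ^+ 2 - (a * q0 - q0 ^+ 2)) / (a * q0 - q0 ^+ 2) +
  N%:R * ((c * (r + e) - q ^+ 2 - (c * (a * q0 + e) - q0 ^+ 2)) /
    (c * (a * q0 + e) - q0 ^+ 2)) < 0.
Proof.
set D := a * q0 - _; set D' := c * (a * q0 + e) - _ => c1 D0 D'0 bal rq ne.
set L := (X in X < 0).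
have -> : L = (q - q0) * ((a - 2 * q0) / D + N%:R * ((c * a - 2 * q0) / D')) -
    ((a * q - r) * (D^-1 + N%:R * (c / D')) +
     (q - q0) ^+ 2 * (D^-1 + N%:R * D'^-1)) by rewrite /L /D /D'; ring.
rewrite bal mulr0 sub0r oppr_lt0.
have k1 : 0 < D^-1 + N%:R * (c / D').
  apply: ltr_wpDr; last by rewrite invr_gt0.
  by rewrite !mulr_ge0 ?invr_ge0 ?ler0n //; lra.
have k2 : 0 < D^-1 + N%:R * D'^-1.
  apply: ltr_wpDr; last by rewrite invr_gt0.
  by rewrite !mulr_ge0 ?invr_ge0 ?ler0n //; lra.
have A : 0 <= (a * q - r) * (D^-1 + N%:R * (c / D')).
  by rewrite mulr_ge0 ?subr_ge0 // ltW.
have B : 0 <= (q - q0) ^+ 2 * (D^-1 + N%:R * D'^-1).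
  by rewrite mulr_ge0 ?sqr_ge0 // ltW.
rewrite lt_neqAle addr_ge0 // andbT eq_sym paddr_eq0 //; apply: contra ne.
rewrite 2!mulf_eq0 (gt_eqF k1) (gt_eqF k2) !orbF sqrf_eq0 !subr_eq0.
by move=> /andP[/eqP <- /eqP ->]; rewrite !eqxx.
Qed.

Lemma edge_G_lt (K : realFieldType) (N : nat) (a c e q r q0 : K) :
  1 < c -> 0 < e -> 0 < q0 < a -> 0 < q < a ->
  (a - 2 * q0) / (a * q0 - q0 ^+ 2) +
    N%:R * ((c * a - 2 * q0) / (c * (a * q0 + e) - q0 ^+ 2)) = 0 ->
  q ^+ 2 < r -> r <= a * q -> (q, r) != (q0, a * q0) ->
  exists2 x, 0 <= x <= a & forall y, 0 <= y <= a ->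
    sens N c e q0 (a * q0) y < sens N c e q r x.
Proof.
move=> c1 e0 /andP[q00 q0a] /andP[q1 qa] bal qr rq ne.
have D : 0 < a * q0 - q0 ^+ 2 by nra.
have D' : 0 < c * (a * q0 + e) - q0 ^+ 2 by apply: edge_det_gt0 => //; lra.
have [c0 a0] : 0 < c /\ 0 < a by lra.
have sens0a : sens N c e q0 (a * q0) a = sens N c e q0 (a * q0) 0.
  apply/eqP; rewrite -subr_eq0; set L := (X in X == _).
  suff -> : L = a * ((a - 2 * q0) / (a * q0 - q0 ^+ 2) +
    N%:R * ((c * a - 2 * q0) / (c * (a * q0 + e) - q0 ^+ 2))) by rewrite bal mulr0.
  by rewrite /L /sens /quad; field; rewrite ?gt_eqF //; apply/andP;
    rewrite !gt_eqF //; nra.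
(* By convexity and equal endpoint values, the maximum at the optimum is the value at 0. *)
have chord y : 0 <= y <= a -> sens N c e q0 (a * q0) y <= sens N c e q0 (a * q0) 0.
  move=> /andP[y0 ya].
  apply: le_trans (_ : _ <= sens N c e q0 (a * q0) 0 + y / a *
    (sens N c e q0 (a * q0) a - sens N c e q0 (a * q0) 0)) _.
    have h1 := @quad_chord _ a 1 q0 (a * q0) y ltr01.
    have h2 := @quad_chord _ a c q0 (a * q0 + e) y c0 D' a0 y0 ya.
    rewrite mul1r in h1; have {}h1 := h1 D a0 y0 ya.
    have {}h2 := ler_wpM2l (ler0n K N) h2.
    rewrite /sens; apply: le_trans (lerD h1 h2) _.
    by rewrite le_eqVlt; apply/orP; left; apply/eqP; ring.
  by rewrite sens0a subrr mulr0 addr0.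
(* Raising r to the edge does not decrease either determinant and leaves the completed squares
   unchanged. *)
have sens_r x : sens N c e q (a * q) x <= sens N c e q r x.
  apply: lerD; first by apply: le_quad => //; lra.
  apply: ler_wpM2l => //; apply: le_quad => //; first exact: pencil_det_gt0.
  by rewrite lerD2r ler_pM2l // lerD2r.
have inc := @quad0_edge_lt K a _ _ _ _ (lexx 1) (lexx 0).
have dec := @quad_edge_lt K a _ _ _ _ (lexx 1) (lexx 0).
have inc' := @quad0_edge_lt K a _ _ _ _ (ltW c1) (ltW e0).
have dec' := @quad_edge_lt K a _ _ _ _ (ltW c1) (ltW e0).
case: (ltgtP q0 q) => [q0q|qq0|qq0].
- exists 0; first by rewrite lexx ltW.
  move=> y /chord /le_lt_trans; apply; apply: lt_le_trans (sens_r 0).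
  apply: ltr_leD; first by have := inc q0 q; rewrite !addr0; apply.
  by apply: ler_wpM2l => //; apply/ltW/inc'.
- exists a; first by rewrite lexx ltW.
  move=> y /chord /le_lt_trans; apply; rewrite -sens0a.
  apply: lt_le_trans (sens_r a).
  apply: ltr_leD; first by have := dec q q0; rewrite !addr0; apply.
  by apply: ler_wpM2l => //; apply/ltW/dec'.
(* With equal means only r < a q is left, and the strict comparison at 0 uses q != 0. *)
- exists 0; first by rewrite lexx ltW.
  move=> y /chord /le_lt_trans; apply; rewrite qq0 in ne *.
  have {}rq : r < a * q.
    by rewrite lt_neqAle rq andbT; apply: contra ne => /eqP ->.
  apply: ltr_leD.
    by apply: lt_quad => //; rewrite ?mulr0 ?mul1r ?gt_eqF //; lra.
  apply: ler_wpM2l => //; apply: le_quad => //; first exact: pencil_det_gt0.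
  by rewrite lerD2r ler_pM2l // lerD2r ltW.
Qed.

(** * Comparison of moments on [-b, b] *)

Lemma variance_lt (K : realFieldType) (q r r0 : K) :
  r <= r0 -> (q, r) != (0, r0) -> r - q ^+ 2 < r0.
Proof.
move=> rr0 ne; have q2 := sqr_ge0 q.
rewrite lt_neqAle; apply/andP; split; last lra.
apply: contra ne => /eqP h; have q20 : q ^+ 2 = 0 by lra.
move/eqP: (q20); rewrite sqrf_eq0 => /eqP q_eq0.
by rewrite -h q20 q_eq0 subr0.
Qed.

(** Both determinants are bounded by their values at (0, b^2), the first strictly. The terms
    [0 ^+ 2] match the general criterion at q0 = 0. *)
Lemma symm_D_lt (K : realFieldType) (N : nat) (b c e q r : K) :
  1 < c -> 0 < e -> 0 < b -> r <= b ^+ 2 -> (q, r) != (0, b ^+ 2) ->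
  (r - q ^+ 2 - (b ^+ 2 - 0 ^+ 2)) / (b ^+ 2 - 0 ^+ 2) +
  N%:R * ((c * (r + e) - q ^+ 2 - (c * (b ^+ 2 + e) - 0 ^+ 2)) /
    (c * (b ^+ 2 + e) - 0 ^+ 2)) < 0.
Proof.
move=> c1 e0 b0 rb ne; rewrite expr0n /= !subr0.
have b2 : 0 < b ^+ 2 by rewrite exprn_gt0.
have q2 := sqr_ge0 q.
rewrite -[ltRHS]addr0; apply: ltr_leD.
  by rewrite pmulr_llt0 ?invr_gt0 // subr_lt0; exact: variance_lt.
rewrite mulr_ge0_le0 ?ler0n // mulr_le0_ge0 //; last first.
  by rewrite invr_ge0 mulr_ge0 ?addr_ge0 //; lra.
have : c * (r + e) <= c * (b ^+ 2 + e) by rewrite ler_pM2l ?lerD2r //; lra.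
by lra.
Qed.

(** At the moments (0, b^2) the sensitivity is even and nondecreasing in |x|, so its maximum is at
    the endpoints. Any other pair is worse at an endpoint not on the side of its mean. *)
Lemma symm_G_lt (K : realFieldType) (N : nat) (b c e q r : K) :
  1 < c -> 0 < e -> 0 < b -> q ^+ 2 < r -> r <= b ^+ 2 -> (q, r) != (0, b ^+ 2) ->
  exists2 x, - b <= x <= b & forall y, - b <= y <= b ->
    sens N c e 0 (b ^+ 2) y < sens N c e q r x.
Proof.
move=> c1 e0 b0 qr rb ne; have c0 : 0 < c by lra.
have b2 : 0 < b ^+ 2 by rewrite exprn_gt0.
have q2 := sqr_ge0 q.
have rD := variance_lt _ _ _ _ rb ne.
have crD : 0 < c * (r + e) - q ^+ 2 by exact: pencil_det_gt0.
have crb : c * (r + e) <= c * (b ^+ 2 + e) by rewrite ler_pM2l ?lerD2r.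
have quad_le p r' x y : 0 < p -> 0 < r' -> y ^+ 2 <= x ^+ 2 ->
    quad p 0 r' y <= quad p 0 r' x.
  move=> p0 r'0 yx; rewrite /quad ler_pM2r.
    by rewrite !mulr0 !mul0r !subr0 lerD2l ler_pM2l.
  by rewrite expr0n subr0 invr_gt0 mulr_gt0.
have sens_le x y : y ^+ 2 <= x ^+ 2 ->
    sens N c e 0 (b ^+ 2) y <= sens N c e 0 (b ^+ 2) x.
  move=> yx; apply: lerD; first exact: quad_le.
  by apply: ler_wpM2l => //; apply: quad_le => //; lra.
(* When q x <= 0, the point p x is at least as far from q as from 0, while the determinants for (q,
   r) are no larger than at the optimum, the first strictly smaller. *)
have sens_lt x : x != 0 -> q * x <= 0 -> sens N c e 0 (b ^+ 2) x < sens N c e q r x.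
  move=> x0 qx; have far p : 0 < p -> (0 - p * x) ^+ 2 <= (q - p * x) ^+ 2.
    move=> p0; have : p * (q * x) <= 0 by rewrite pmulr_rle0.
    by lra.
  apply: ltr_leD.
    apply: lt_quad; [exact: ltr01| | |exact: far|].
    - by rewrite mul1r subr_gt0.
    - by rewrite !mul1r expr0n subr0.
    - by rewrite mul1r eq_sym.
  by apply: ler_wpM2l => //; apply: le_quad => //; [rewrite expr0n /=; lra|exact: far].
case: (lerP 0 q) => q0.
- exists (- b); first by rewrite lexx /=; lra.
  move=> y /andP[y1 y2]; apply: le_lt_trans (sens_lt (- b) _ _).
  + by apply: sens_le; rewrite sqrrN; nra.
  + by rewrite oppr_eq0 gt_eqF.
  + by rewrite mulrN oppr_le0 mulr_ge0 // ltW.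
- exists b; first by rewrite lexx andbT; lra.
  move=> y /andP[y1 y2]; apply: le_lt_trans (sens_lt b _ _).
  + by apply: sens_le; nra.
  + by rewrite gt_eqF.
  + by rewrite nmulr_rle0 // ltW.
Qed.

(** * Explicit matrices of order two *)

Lemma lift00_ord2 : (lift 0 0 : 'I_2) = 1.
Proof. exact/val_inj. Qed.

Lemma det_mx2 (K : comPzRingType) (M : 'M[K]_2) :
  \det M = M 0 0 * M 1 1 - M 0 1 * M 1 0.
Proof.
rewrite (expand_det_row _ 0) !big_ord_recl big_ord0 /cofactor !det_mx11 !mxE /=.
rewrite !lift00_ord2 expr0 expr1 addr0 mul1r mulN1r mulrN.
by congr (_ * M _ _ - _ * M _ _); exact/val_inj.
Qed.

Lemma invmx_eq (K : comUnitRingType) (n : nat) (A B : 'M[K]_n) :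
  A *m B = 1%:M -> invmx A = B.
Proof.
by move=> AB; have [uA _] := mulmx1_unit AB; rewrite -[LHS]mulmx1 -AB mulKmx.
Qed.

Definition mx2 {K : pzSemiRingType} (x y z t : K) : 'M[K]_2 :=
  \matrix_(i, j) (if val i is 0%N then if val j is 0%N then x else y
                  else if val j is 0%N then z else t).

Lemma mul_mx2 (K : pzSemiRingType) (x y z t x' y' z' t' : K) :
  mx2 x y z t *m mx2 x' y' z' t' =
  mx2 (x * x' + y * z') (x * y' + y * t') (z * x' + t * z') (z * y' + t * t').
Proof.
by apply/matrixP => -[[|[|//]] i] [[|[|//]] j];
  rewrite !mxE !big_ord_recl big_ord0 !mxE /= addr0.
Qed.

Lemma add_mx2 (K : pzSemiRingType) (x y z t x' y' z' t' : K) :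
  mx2 x y z t + mx2 x' y' z' t' = mx2 (x + x') (y + y') (z + z') (t + t').
Proof. by apply/matrixP => -[[|[|//]] i] [[|[|//]] j]; rewrite !mxE. Qed.

Lemma mx2_1 (K : pzSemiRingType) : 1%:M = mx2 1 0 0 1 :> 'M[K]_2.
Proof. by apply/matrixP => -[[|[|//]] i] [[|[|//]] j]; rewrite !mxE. Qed.

Lemma det_mx2E (K : comPzRingType) (x y z t : K) :
  \det (mx2 x y z t) = x * t - y * z.
Proof. by rewrite det_mx2 !mxE. Qed.

Lemma invmx_mx2 (K : fieldType) (p q r : K) : p * r - q ^+ 2 != 0 ->
  let D := p * r - q ^+ 2 in
  invmx (mx2 p q q r) = mx2 (r / D) (- q / D) (- q / D) (p / D).
Proof.
move=> D0 D; apply: invmx_eq; rewrite mul_mx2 mx2_1.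
by congr mx2; rewrite /D; field.
Qed.

Lemma invmx_diag2 (R : realType) (d1 d2 : R) (m : nat) :
  m%:R * d1 != 0 -> m%:R * d2 != 0 ->
  invmx (m%:R *: diag2 d1 d2) = mx2 (m%:R * d1)^-1 0 0 (m%:R * d2)^-1.
Proof.
move=> h1 h2; apply: invmx_eq.
have -> : m%:R *: diag2 d1 d2 = mx2 (m%:R * d1) 0 0 (m%:R * d2).
  by apply/matrixP => -[[|[|//]] i] [[|[|//]] j]; rewrite !mxE ?mulr1n ?mulr0n ?mulr0.
by rewrite mul_mx2 mx2_1 !mul0r !mulr0 !addr0 !add0r !mulfV.
Qed.

Lemma straight_line_quad (R : realType) (p q r x : R) :
  p * r - q ^+ 2 != 0 ->
  ((straight_line x)^T *m invmx (mx2 p q q r) *m straight_line x) 0 0 =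
  quad p q r x.
Proof.
move=> D0; rewrite invmx_mx2 // mxE !big_ord_recl big_ord0 !mxE.
rewrite !big_ord_recl !big_ord0 !mxE /= /quad.
by field.
Qed.

(** * Moments of a design and the two criteria *)

Definition design_mean {R : realType} {X : set R} (xi : design X) : R :=
  \sum_j design_wt xi j * design_pt xi j.

Definition design_msq {R : realType} {X : set R} (xi : design X) : R :=
  \sum_j design_wt xi j * design_pt xi j ^+ 2.

Lemma information_straight_line (R : realType) (X : set R) (xi : design X) :
  information (@straight_line R) xi =
  mx2 1 (design_mean xi) (design_mean xi) (design_msq xi).
Proof.
apply/matrixP => i j; rewrite /information summxE mxE.
under eq_bigr do rewrite !mxE big_ord1 !mxE.
case: i j => [[|[|//]] i] [[|[|//]] j] /=.
- by rewrite -[RHS](design_wt_sum xi); apply: eq_bigr => k _; rewrite !mulr1.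
- by apply: eq_bigr => k _; rewrite mul1r.
- by apply: eq_bigr => k _; rewrite mulr1.
- by apply: eq_bigr => k _; rewrite expr2.
Qed.

(** The difference is a weighted sum of squares about the mean. *)
Lemma variance_ge0 (R : realType) (X : set R) (xi : design X) :
  design_mean xi ^+ 2 <= design_msq xi.
Proof.
rewrite -subr_ge0; set q := design_mean xi.
have -> : design_msq xi - q ^+ 2 =
    \sum_j design_wt xi j * (design_pt xi j - q) ^+ 2.
  transitivity (\sum_j (design_wt xi j * design_pt xi j ^+ 2 -
      2 * q * (design_wt xi j * design_pt xi j) + q ^+ 2 * design_wt xi j)).
    rewrite big_split sumrB /= -!mulr_sumr design_wt_sum.
    by rewrite -/(design_mean xi) -/(design_msq xi) -/q; ring.
  by apply: eq_bigr => j _; ring.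
by apply: sumr_ge0 => j _; rewrite mulr_ge0 ?design_wt_ge0 ?sqr_ge0.
Qed.

(** The determinant is the variance, which is never negative. *)
Lemma nonsingular_straight_line (R : realType) (X : set R) (xi : design X) :
  nonsingular (@straight_line R) xi = (design_mean xi ^+ 2 < design_msq xi).
Proof.
rewrite /nonsingular information_straight_line unitmxE det_mx2E mul1r -expr2.
by rewrite unitfE subr_eq0 lt_neqAle variance_ge0 andbT eq_sym.
Qed.

(** Passage from matrices to moments. Writing n as [N.+1] turns the exponent and the factor n - 1
    into [N]. *)
Lemma straight_line_criteria (R : realType) (X : set R) (m N : nat) (d1 d2 : R)
    (xi : design X) : (0 < m)%N -> 0 < d1 -> 0 < d2 ->
  nonsingular (@straight_line R) xi ->
  let c := 1 + (m%:R * d1)^-1 in let e := (m%:R * d2)^-1 in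
  let q := design_mean xi in let r := design_msq xi in
  \det (MSE (@straight_line R) N.+1 (m%:R *: diag2 d1 d2) xi) =
    ((r - q ^+ 2) * (c * (r + e) - q ^+ 2) ^+ N)^-1 /\
  sensitivity (@straight_line R) N.+1 (m%:R *: diag2 d1 d2) xi = sens N c e q r.
Proof.
move=> m0 d10 d20; rewrite nonsingular_straight_line => qr c e q r.
have md (d : R) : 0 < d -> 0 < m%:R * d by move=> d0; rewrite mulr_gt0 // ltr0n.
have c1 : 1 < c by rewrite ltrDl invr_gt0 md.
have e0 : 0 < e by rewrite invr_gt0 md.
have D0 : 0 < 1 * r - q ^+ 2 by rewrite mul1r subr_gt0.
have D'0 := pencil_det_gt0 _ _ _ _ _ c1 e0 qr.
have E : information (@straight_line R) xi + invmx (m%:R *: diag2 d1 d2) =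
    mx2 c q q (r + e).
  by rewrite information_straight_line invmx_diag2 ?gt_eqF ?md // add_mx2 !addr0.
split.
  rewrite det_MSE; last by rewrite E unitmxE det_mx2E -expr2 unitfE gt_eqF.
  by rewrite E information_straight_line !det_mx2E -!expr2 mul1r.
apply/funext => x; rewrite /sensitivity E information_straight_line.
rewrite mulmxDr mulmxDl -scalemxAr -scalemxAl mxE [X in _ + X = _]mxE.
by rewrite !straight_line_quad ?gt_eqF.
Qed.

(** * Equivalence from a common optimal pair of moments *)

(** Each criterion is strictly smaller at (q0, r0) than at any other pair of moments, so optimality
    in either sense means having these moments. *)
Lemma D_optimal_iff_G_optimal (R : realType) (X : set R) (m N : nat)
    (d1 d2 q0 r0 : R) : (0 < m)%N -> 0 < d1 -> 0 < d2 ->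
  compact X -> q0 ^+ 2 < r0 ->
  (exists eta : design X, design_mean eta = q0 /\ design_msq eta = r0) ->
  let c := 1 + (m%:R * d1)^-1 in let e := (m%:R * d2)^-1 in
  (forall eta : design X, let q := design_mean eta in let r := design_msq eta in
    q ^+ 2 < r -> (q, r) != (q0, r0) ->
    (r - q ^+ 2 - (r0 - q0 ^+ 2)) / (r0 - q0 ^+ 2) +
    N%:R * ((c * (r + e) - q ^+ 2 - (c * (r0 + e) - q0 ^+ 2)) /
      (c * (r0 + e) - q0 ^+ 2)) < 0 /\
    exists2 x, X x & forall y, X y -> sens N c e q0 r0 y < sens N c e q r x) ->
  forall xi : design X, nonsingular (@straight_line R) xi ->
    (D_optimal (@straight_line R) N.+1 (m%:R *: diag2 d1 d2) xi <->
     G_optimal (@straight_line R) N.+1 (m%:R *: diag2 d1 d2) xi).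
Proof.
move=> m0 d10 d20 cX q0r0 [opt [opt_q opt_r]] c e best.
set f := @straight_line R; set Delta := _ *: _.
have c1 : 1 < c by rewrite ltrDl invr_gt0 mulr_gt0 // ltr0n.
have e0 : 0 < e by rewrite invr_gt0 mulr_gt0 // ltr0n.
have crit (eta : design X) (h : nonsingular f eta) :=
  straight_line_criteria R X m N d1 d2 eta m0 d10 d20 h.
have ns_opt : nonsingular f opt by rewrite nonsingular_straight_line opt_q opt_r.
(* The weights of [opt] sum to 1, so it has a point; [X] is then nonempty and the supremum in [PhiG]
   is attained. *)
have [x0 Xx0] : X !=set0.
  case: {opt_q opt_r ns_opt} opt => -[|k] pt wt _ Xpt _ wt1.
    by move: wt1; rewrite big_ord0 => /esym/eqP; rewrite oner_eq0.
  by exists (pt ord0).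
have PhiG_attained (eta : design X) :=
  @PhiG_max R X 2 f N.+1 Delta eta cX (ex_intro _ x0 Xx0)
    (@continuous_straight_line R).
have strict (eta : design X) : nonsingular f eta ->
    (design_mean eta, design_msq eta) != (q0, r0) ->
    \det (MSE f N.+1 Delta opt) < \det (MSE f N.+1 Delta eta) /\
    PhiG f N.+1 Delta opt < PhiG f N.+1 Delta eta.
  move=> ns ne; have [De Se] := crit _ ns; have [Do So] := crit _ ns_opt.
  move: (ns); rewrite nonsingular_straight_line => qr.
  have [Dlt [x Xx Slt]] := best _ qr ne.
  split.
    rewrite De Do opt_q opt_r.
    have pos := pencil_det_gt0 _ _ _ _ _ c1 e0 qr.
    have pos0 := pencil_det_gt0 _ _ _ _ _ c1 e0 q0r0.
    have v : 0 < design_msq eta - design_mean eta ^+ 2 by rewrite subr_gt0.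
    have v0 : 0 < r0 - q0 ^+ 2 by rewrite subr_gt0.
    by rewrite ltf_pV2 ?posrE ?mulr_gt0 ?exprn_gt0 //; exact: mul_exprn_lt.
  (* The supremum for [opt] is attained at some [y]; the one for [eta] is at least the sensitivity
     at the bad point [x]. *)
  have [y Xy [-> _]] := PhiG_attained opt.
  have [_ _ [_ /(_ x Xx)]] := PhiG_attained eta.
  by move=> /(lt_le_trans _); apply; rewrite So Se opt_q opt_r; exact: Slt.
have same (eta : design X) :
    (design_mean eta, design_msq eta) = (q0, r0) ->
    information f eta = information f opt.
  by move=> [hq hr]; rewrite !information_straight_line hq hr opt_q opt_r.
have le_opt (eta : design X) : nonsingular f eta ->
    \det (MSE f N.+1 Delta opt) <= \det (MSE f N.+1 Delta eta) /\
    PhiG f N.+1 Delta opt <= PhiG f N.+1 Delta eta.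
  move=> ns; have [/same E|ne] :=
      eqVneq (design_mean eta, design_msq eta) (q0, r0).
    by rewrite /PhiG /sensitivity /MSE E.
  by have [/ltW ? /ltW ?] := strict _ ns ne.
move=> xi ns; have [/same E|ne] :=
    eqVneq (design_mean xi, design_msq xi) (q0, r0).
  split=> _; split=> // eta /le_opt[lD lG].
    by move: lG; rewrite /PhiG /sensitivity E.
  by move: lD; rewrite /MSE E.
(* With other moments [xi] is beaten by [opt] under both criteria, so both sides are false. *)
have [ltD ltG] := strict _ ns ne.
split=> -[_ /(_ opt ns_opt)]; first by rewrite leNgt ltD.
by rewrite leNgt ltG.
Qed.

(** * Attaining and bounding moments *)

Lemma two_point_moments (R : realType) (X : set R) (x y w : R) :
  X x -> X y -> x != y -> 0 <= w <= 1 ->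
  exists eta : design X, design_mean eta = (1 - w) * x + w * y /\
    design_msq eta = (1 - w) * x ^+ 2 + w * y ^+ 2.
Proof.
move=> Xx Xy xy /andP[w0 w1].
pose pt (i : 'I_2) := if val i is 0%N then x else y.
pose wt (i : 'I_2) := if val i is 0%N then 1 - w else w.
have pt_inj : injective pt.
  move=> [[|[|//]] i] [[|[|//]] j] /eqP; rewrite /pt /=.
  - by move=> _; exact/val_inj.
  - by rewrite (negPf xy).
  - by rewrite eq_sym (negPf xy).
  - by move=> _; exact/val_inj.
have pt_in j : X (pt j) by case: j => [[|[|//]] j].
have wt_ge0 j : 0 <= wt j by case: j => [[|[|//]] j]; rewrite /wt /= ?subr_ge0.
have wt_sum : \sum_j wt j = 1.
  by rewrite !big_ord_recl big_ord0 /wt /= addr0 subrK.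
exists (@Design R X 2 pt wt pt_inj pt_in wt_ge0 wt_sum).
by rewrite /design_mean /design_msq !big_ord_recl !big_ord0 /wt /pt /= !addr0.
Qed.

(** An affine bound on x^2 averages over the design. It is used with a x on [0, a] and with the
    constant b^2 on [-b, b]. *)
Lemma design_msq_le (R : realType) (X : set R) (xi : design X) (k l : R) :
  (forall x, X x -> x ^+ 2 <= k * x + l) ->
  design_msq xi <= k * design_mean xi + l.
Proof.
move=> h; rewrite -[l in leRHS]mulr1 -(design_wt_sum xi) !mulr_sumr -big_split /=.
apply: ler_sum => j _.
rewrite [leRHS](_ : _ = design_wt xi j * (k * design_pt xi j + l)); last ring.
by apply: ler_wpM2l; [exact: design_wt_ge0|exact/h/design_pt_in].
Qed.

(** * The two experimental regions *)

Theorem mainTheorem6 (R : realType) (m n : nat) (d1 d2 : R)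
    (hm : (1 <= m)%N) (hn : (1 <= n)%N) (hd1 : 0 < d1) (hd2 : 0 < d2) :
  (forall a : R, 0 < a ->
     forall xi : design `[0, a]%classic, nonsingular (@straight_line R) xi ->
       (D_optimal (@straight_line R) n (m%:R *: diag2 d1 d2) xi <->
        G_optimal (@straight_line R) n (m%:R *: diag2 d1 d2) xi)) /\
  (forall b : R, 0 < b ->
     forall xi : design `[- b, b]%classic, nonsingular (@straight_line R) xi ->
       (D_optimal (@straight_line R) n (m%:R *: diag2 d1 d2) xi <->
        G_optimal (@straight_line R) n (m%:R *: diag2 d1 d2) xi)).
Proof.
case: n hn => // N _; have md (d : R) : 0 < d -> 0 < (m%:R * d)^-1.
  by move=> d0; rewrite invr_gt0 mulr_gt0 // ltr0n.
have c1 : 1 < 1 + (m%:R * d1)^-1 by rewrite ltrDl md.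
have e0 := md _ hd2.
split=> [a a0|b b0].
- have [q0 /andP[q00 q0a] bal] := edge_balance R N a _ _ a0 c1 e0.
  have D0 : 0 < a * q0 - q0 ^+ 2.
    by rewrite expr2 -mulrBl mulr_gt0 // subr_gt0.
  apply: (D_optimal_iff_G_optimal R _ m N d1 d2 q0 (a * q0)) => //.
  + exact: segment_compact.
  + by rewrite -subr_gt0.
  (* Weight q0 / a at [a] and the rest at 0 give the moments q0 and a q0. *)
  + have [||||eta [Eq Er]] := two_point_moments R `[0, a]%classic 0 a (q0 / a).
    * by rewrite /= in_itv /= lexx ltW.
    * by rewrite /= in_itv /= lexx ltW.
    * by rewrite lt_eqF.
    * by rewrite ler_pdivlMr // mul0r ler_pdivrMr // mul1r !ltW.
    * by exists eta; rewrite Eq Er; split; field; rewrite gt_eqF.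
  + move=> eta q r qr ne.
    have rq : r <= a * q.
      rewrite -[leRHS]addr0; apply: design_msq_le => x.
      rewrite /= in_itv /= => /andP[x0 xa].
      by rewrite addr0 expr2 ler_wpM2r.
    (* Nonsingularity keeps the mean strictly inside: 0 < r <= a q and q^2 < r <= a q. *)
    have r0 : 0 < r by apply: le_lt_trans qr; exact: sqr_ge0.
    have q1 : 0 < q by rewrite -(pmulr_rgt0 _ a0) (lt_le_trans r0).
    have qa : q < a by rewrite -(ltr_pM2r q1) -expr2 (lt_le_trans qr).
    split; first by apply: edge_D_lt => //; exact: edge_det_gt0 (ltW c1) (ltW e0) _ _.
    have [||x xX xlt] := edge_G_lt _ N a _ _ q r q0 c1 e0 _ _ bal qr rq ne.
    * by rewrite q00.
    * by rewrite q1.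
    * by exists x => [|y]; rewrite /= in_itv //=; exact: xlt.
- apply: (D_optimal_iff_G_optimal R _ m N d1 d2 0 (b ^+ 2)) => //.
  + exact: segment_compact.
  + by rewrite expr0n exprn_gt0.
  (* Equal weights at both endpoints give the moments 0 and b^2. *)
  + have [||||eta [Eq Er]] := two_point_moments R `[- b, b]%classic (- b) b 2^-1.
    * by rewrite /= in_itv /= lexx; lra.
    * by rewrite /= in_itv /= lexx andbT; lra.
    * by rewrite lt_eqF //; lra.
    * by apply/andP; split; lra.
    * by exists eta; rewrite Eq Er; split; field.
  + move=> eta q r qr ne.
    have rb : r <= b ^+ 2.
      rewrite -[leRHS]add0r -[0 in leRHS](mul0r q); apply: design_msq_le => x.
      rewrite /= in_itv /= => /andP[x0 xb].
      by rewrite mul0r add0r; nra.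
    split; first exact: symm_D_lt.
    have [x xX xlt] := symm_G_lt _ N b _ _ q r c1 e0 b0 qr rb ne.
    by exists x => [|y]; rewrite /= in_itv //=; exact: xlt.
Qed.
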